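(* Let $\mathcal A$ be a Banach operator ideal. The Banach Lipschitz operator ideal $\mathrm{Lip}_0\circ\mathcal A^{\min}\circ\mathrm{Lip}_0$ is not minimal.
   Context: Banach spaces are real; $\mathcal L(E,F)$ is the space of bounded linear operators and $\overline{\mathcal F}(E,F)$ the operator-norm closure of the finite-rank operators (approximable operators). A Banach operator ideal $\mathcal A$ is a Banach ideal of bounded linear operators in the sense of Pietsch, with norm $\|\cdot\|_{\mathcal A}$. Its minimal kernel is $\mathcal A^{\min}=\overline{\mathcal F}\circ\mathcal A\circ\overline{\mathcal F}$, i.e. operators $T=R\circ S\circ U$ with $U,R$ approximable and $S\in\mathcal A$, with norm $\inf\|R\|\|S\|_{\mathcal A}\|U\|$. A pointed metric space has a distinguished point $0$ (for a Banach space, its origin). $\mathrm{Lip}_0(X,Y)$ is the set of Lipschitz maps $f\colon X\to Y$ with $f(0)=0$, and $\mathrm{Lip}(f)$ is the least Lipschitz constant. A Banach Lipschitz operator ideal $\mathcal I$ assigns to each pointed metric space $X$ and Banach space $E$ a linear subspace $\mathcal I(X,E)\subset \mathrm{Lip}_0(X,E)$ with a norm $\|\cdot\|_{\mathcal I}$ such that: $(\mathcal I(X,E),\|\cdot\|_{\mathcal I})$ is a Banach space and $\mathrm{Lip}(f)\le\|f\|_{\mathcal I}$; $Id_{\mathbb R}\in\mathcal I(\mathbb R,\mathbb R)$ with norm $1$; if $g\in\mathrm{Lip}_0(Y,X)$, $f\in\mathcal I(X,E)$, $S\in\mathcal L(E,F)$, then $S\circ f\circ g\in\mathcal I(Y,F)$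 and $\|S\circ f\circ g\|_{\mathcal I}\le \|S\|\,\|f\|_{\mathcal I}\,\mathrm{Lip}(g)$. $\mathcal I\subset\mathcal J$ means $\mathcal I(X,E)\subset\mathcal J(X,E)$ and $\|\cdot\|_{\mathcal J}\le\|\cdot\|_{\mathcal I}$ for all $X,E$; equality means both inclusions. $\mathcal I$ and $\mathcal J$ are related if $\mathcal I(X_0,E_0)=\mathcal J(X_0,E_0)$ isometrically for all finite pointed metric spaces $X_0$ and finite-dimensional Banach spaces $E_0$. The minimal kernel $\mathcal I^{\min}$ is the (known to exist, unique) smallest Banach Lipschitz operator ideal related with $\mathcal I$: it is related with $\mathcal I$, and $\mathcal I^{\min}\subset\mathcal J$ for every $\mathcal J$ related with $\mathcal I$. $\mathcal I$ is minimal if $\mathcal I=\mathcal I^{\min}$. For a Banach operator ideal $\mathcal B$, $\mathrm{Lip}_0\circ\mathcal B\circ\mathrm{Lip}_0(X,E)$ is the set of $f=g_2\circ T\circ g_1$ with $G_1,G_2$ Banach spaces, $g_1\in\mathrm{Lip}_0(X,G_1)$, $T\in\mathcal B(G_1,G_2)$, $g_2\in\mathrm{Lip}_0(G_2,E)$, with norm $\inf\mathrm{Lip}(g_1)\|T\|_{\mathcal B}\mathrm{Lip}(g_2)$; it is a Banach Lipschitz operator ideal. *)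

(* Defs.v *)
From HB Require Import structures.
From mathcomp Require Import all_boot all_order all_algebra.
From mathcomp Require Import all_classical all_reals all_analysis.

Set Implicit Arguments.
Unset Strict Implicit.
Unset Printing Implicit Defensive.

Import Order.TTheory GRing.Theory Num.Theory.
Import numFieldNormedType.Exports.

Local Open Scope classical_set_scope.
Local Open Scope ring_scope.

(* A real Banach space is a [completeNormedModType R] with [R : realType]; maps
   are bare functions singled out by predicates, so that [X -> E] carries its
   canonical [lmodType R]. *)

Record pointedMetric (R : realType) := PointedMetric {
  pm_sort :> metricType R;
  pm_base : pm_sort }.

(* [normedModType] does not inherit from [metricType], hence the explicit
   construction below: the space itself with [mdist x y = `|y - x|]. *)
Section BanachMetric.
Context {R : realType} (E : completeNormedModType R).

Let dist (x y : E) : R := `|y - x|.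

Let dist_ge0 x y : 0 <= dist x y.
Proof. exact: normr_ge0. Qed.

Let dist_positivity x y : dist x y = 0 -> x = y.
Proof. by move/normr0_eq0/eqP; rewrite subr_eq0 => /eqP. Qed.

Let ballEdist (x : E) (d : R) : ball x d = [set y | dist x y < d].
Proof.
by rewrite -ball_normE; apply/seteqP; split => y; rewrite /ball_ /dist/= distrC.
Qed.

Definition banach_metric : metricType R :=
  HB.pack_for (metricType R) (CompleteNormedModule.sort E)
    (@PseudoMetric_isMetric.Build R E dist dist_ge0 dist_positivity ballEdist).

End BanachMetric.

Definition banach_pm (R : realType) (E : completeNormedModType R) :
  pointedMetric R := @PointedMetric R (banach_metric E) (0 : E).

Definition lip_bound (R : realType) (X Y : pointedMetric R) (f : X -> Y)
    (c : R) : Prop :=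
  0 <= c /\ forall x y, mdist (f x) (f y) <= c * mdist x y.

Definition Lip0 (R : realType) (X Y : pointedMetric R) : set (X -> Y) :=
  [set f | f (pm_base X) = pm_base Y /\ exists c, lip_bound f c].

Definition Lip (R : realType) (X Y : pointedMetric R) (f : X -> Y) : R :=
  inf [set c | lip_bound f c].

Definition op_bound (R : realType) (E F : completeNormedModType R)
    (T : E -> F) (c : R) : Prop :=
  0 <= c /\ forall x, `|T x| <= c * `|x|.

Definition bounded_op (R : realType) (E F : completeNormedModType R) :
    set (E -> F) :=
  [set T | linear T /\ exists c, op_bound T c].

Definition opnorm (R : realType) (E F : completeNormedModType R)
    (T : E -> F) : R :=
  inf [set c | op_bound T c].

Definition finite_dim (R : realType) (E : completeNormedModType R) : Prop :=
  exists (n : nat) (v : 'I_n -> E),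
    forall x, exists c : 'I_n -> R, x = \sum_(i < n) c i *: v i.

Definition finite_rank (R : realType) (E F : completeNormedModType R) :
    set (E -> F) :=
  [set T | bounded_op T /\ exists (n : nat) (v : 'I_n -> F),
    forall x, exists c : 'I_n -> R, T x = \sum_(i < n) c i *: v i].

Definition approximable (R : realType) (E F : completeNormedModType R) :
    set (E -> F) :=
  [set T | bounded_op T /\ forall e : R, 0 < e ->
    exists L : E -> F, finite_rank L /\ opnorm (T \- L) < e].

(* [P] is a linear subspace of [V] on which [N] is a complete norm; the values
   of [N] outside [P] are irrelevant. *)
Record banach_subspace (R : realType) (V : lmodType R) (P : set V)
    (N : V -> R) : Prop := {
  bs_zero : P 0;
  bs_lin : forall (a : R) u v, P u -> P v -> P (a *: u + v);
  bs_ge0 : forall u, P u -> 0 <= N u;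
  bs_definite : forall u, P u -> N u = 0 -> u = 0;
  bs_scale : forall (a : R) u, P u -> N (a *: u) = `|a| * N u;
  bs_triangle : forall u v, P u -> P v -> N (u + v) <= N u + N v;
  bs_complete : forall u : nat -> V, (forall n, P (u n)) ->
    (forall e, 0 < e -> exists k, forall m n, (k <= m)%N -> (k <= n)%N ->
       N (u m - u n) < e) ->
    exists2 l, P l & forall e, 0 < e -> exists k, forall n, (k <= n)%N ->
       N (u n - l) < e }.

(* A class of operators together with a real function on each component; for
   [op_norm A], only the values on [op_in A] matter. *)
Record opClass (R : realType) := OpClass {
  op_in : forall E F : completeNormedModType R, set (E -> F);
  op_norm : forall E F : completeNormedModType R, (E -> F) -> R }.

Record banach_operator_ideal (R : realType) (A : opClass R) : Prop := {
  boi_sub : forall E F, @op_in R A E F `<=` @bounded_op R E F;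
  boi_banach : forall E F, banach_subspace (@op_in R A E F) (@op_norm R A E F);
  boi_id : @op_in R A R^o R^o id;
  boi_id_norm : @op_norm R A R^o R^o id = 1;
  boi_comp : forall (E0 E F F0 : completeNormedModType R)
      (U : E0 -> E) (S : E -> F) (W : F -> F0),
    bounded_op U -> op_in A S -> bounded_op W -> op_in A (W \o S \o U);
  boi_comp_norm : forall (E0 E F F0 : completeNormedModType R)
      (U : E0 -> E) (S : E -> F) (W : F -> F0),
    bounded_op U -> op_in A S -> bounded_op W ->
    op_norm A (W \o S \o U) <= opnorm W * op_norm A S * opnorm U }.

(* The numbers |W| |S|_A |U| over all factorizations T = W S U through an
   operator S of A with U and W approximable. *)
Definition op_min_costs (R : realType) (A : opClass R)
    (E F : completeNormedModType R) (T : E -> F) : set R :=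
  [set r | exists (G1 G2 : completeNormedModType R)
      (U : E -> G1) (S : G1 -> G2) (W : G2 -> F),
    [/\ approximable U, op_in A S, approximable W, T = W \o S \o U &
        r = opnorm W * op_norm A S * opnorm U]].

Definition op_min (R : realType) (A : opClass R) : opClass R :=
  {| op_in := fun E F => [set T | op_min_costs A T !=set0];
     op_norm := fun E F T => inf (@op_min_costs R A E F T) |}.

Record lipClass (R : realType) := LipClass {
  lip_in : forall (X : pointedMetric R) (E : completeNormedModType R),
    set (X -> E);
  lip_norm : forall (X : pointedMetric R) (E : completeNormedModType R),
    (X -> E) -> R }.

Record banach_lip_ideal (R : realType) (I : lipClass R) : Prop := {
  bli_sub : forall X E, @lip_in R I X E `<=` @Lip0 R X (banach_pm E);
  bli_banach : forall X E,
    banach_subspace (@lip_in R I X E) (@lip_norm R I X E);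
  bli_Lip : forall (X : pointedMetric R) (E : completeNormedModType R)
      (f : X -> E),
    lip_in I f -> @Lip R X (banach_pm E) f <= lip_norm I f;
  bli_id : @lip_in R I (banach_pm R^o) R^o id;
  bli_id_norm : @lip_norm R I (banach_pm R^o) R^o id = 1;
  bli_comp : forall (Y X : pointedMetric R) (E F : completeNormedModType R)
      (g : Y -> X) (f : X -> E) (S : E -> F),
    Lip0 g -> lip_in I f -> bounded_op S -> lip_in I (S \o f \o g);
  bli_comp_norm : forall (Y X : pointedMetric R)
      (E F : completeNormedModType R) (g : Y -> X) (f : X -> E) (S : E -> F),
    Lip0 g -> lip_in I f -> bounded_op S ->
    lip_norm I (S \o f \o g) <= opnorm S * lip_norm I f * Lip g }.

Definition lip_le (R : realType) (I J : lipClass R) : Prop :=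
  forall (X : pointedMetric R) (E : completeNormedModType R) (f : X -> E),
    lip_in I f -> lip_in J f /\ lip_norm J f <= lip_norm I f.

Definition lip_eq (R : realType) (I J : lipClass R) : Prop :=
  lip_le I J /\ lip_le J I.

Definition lip_related (R : realType) (I J : lipClass R) : Prop :=
  forall (X : pointedMetric R) (E : completeNormedModType R),
    finite_set [set: X] -> finite_dim E ->
    @lip_in R I X E = @lip_in R J X E /\
    forall f : X -> E, lip_in I f -> lip_norm I f = lip_norm J f.

(* [K] is the smallest Banach Lipschitz operator ideal related with [I]; this
   determines [K] up to [lip_eq]. *)
Definition is_lip_min (R : realType) (I K : lipClass R) : Prop :=
  [/\ banach_lip_ideal K, lip_related K I &
      forall J, banach_lip_ideal J -> lip_related J I -> lip_le K J].

Definition lip_minimal (R : realType) (I : lipClass R) : Prop :=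
  exists2 K, is_lip_min I K & lip_eq I K.

(* The numbers Lip(g1) |T|_B Lip(g2) over all factorizations f = g2 T g1. *)
Definition lip_op_lip_costs (R : realType) (B : opClass R)
    (X : pointedMetric R) (E : completeNormedModType R) (f : X -> E) : set R :=
  [set r | exists (G1 G2 : completeNormedModType R)
      (g1 : X -> banach_pm G1) (T : G1 -> G2)
      (g2 : banach_pm G2 -> banach_pm E),
    [/\ Lip0 g1, op_in B T, Lip0 g2, f = g2 \o T \o g1 &
        r = Lip g1 * op_norm B T * Lip g2]].

Definition lip_op_lip (R : realType) (B : opClass R) : lipClass R :=
  {| lip_in := fun X E => [set f | lip_op_lip_costs B f !=set0];
     lip_norm := fun X E f => inf (@lip_op_lip_costs R B X E f) |}.

(* Main.v *)
(** Restricting an ideal [K] to the maps that are limits, for the Lipschitz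
    constant, of maps with finite-dimensional range gives an ideal related with
    [K].  A minimal ideal therefore contains only such limits.  On the other
    hand [Lip0 o A^min o Lip0] contains every Lipschitz map on the real line, as
    the identity of [R] lies in [A^min]; take the evaluation [t |-> delta_t]
    into the bounded functions on the set of normalized 1-Lipschitz functions.
    Its increments [delta_(i+1) - delta_i] span isometrically a copy of [l^1],
    and vectors within distance 1/2 of the basis of [l^1] are linearly
    independent, so no map with finite-dimensional range is within Lipschitz
    distance 1/2 of it. *)

From HB Require Import structures.
Require Import Defs.
From mathcomp Require Import all_boot all_order all_algebra.
From mathcomp Require Import all_classical all_reals all_analysis.
From mathcomp Require Import zify ring lra.

Set Implicit Arguments.
Unset Strict Implicit.
Unset Printing Implicit Defensive.

Import Order.TTheory GRing.Theory Num.Theory.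
Import numFieldNormedType.Exports.

Local Open Scope classical_set_scope.
Local Open Scope ring_scope.

(** * The Banach space of bounded functions *)

Section LInfty.
Context {R : realType} (T : Type).

Definition linf_pred : {pred T -> R} :=
  [pred f | `[< exists M : R, forall t, `|f t| <= M >]].

Fact linf_submod_closed : submod_closed linf_pred.
Proof.
split=> [|a f g /asboolP[M fM] /asboolP[N gN]]; apply/asboolP.
  by exists 0 => t; rewrite normr0.
exists (`|a| * M + N) => t.
by rewrite (le_trans (ler_normD _ _))// lerD// normrM ler_wpM2l.
Qed.

HB.instance Definition _ :=
  GRing.isSubmodClosed.Build R (T -> R) linf_pred linf_submod_closed.

Record linf := Linf { linf_fun :> T -> R; _ : linf_fun \in linf_pred }.

HB.instance Definition _ := [isSub for linf_fun].
HB.instance Definition _ := [Choice of linf by <:].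
HB.instance Definition _ := [SubChoice_isSubLmodule of linf by <:].

Implicit Types f g : linf.

(** The supremum norm; [0 <= c] keeps the set of bounds bounded below even when [T] is empty. *)
Definition linf_norm f := inf [set c | 0 <= c /\ forall t, `|f t| <= c].

Lemma linf_norm_nonempty f : [set c | 0 <= c /\ forall t, `|f t| <= c] !=set0.
Proof.
case: f => f /= /asboolP[M fM]; exists (Num.max 0 M); split=> [|t].
  by rewrite le_max lexx.
by rewrite le_max fM orbT.
Qed.

Lemma linf_norm_ge f t : `|f t| <= linf_norm f.
Proof. by apply: lb_le_inf (linf_norm_nonempty f) _ => c [_]. Qed.

Lemma linf_norm_ge0 f : 0 <= linf_norm f.
Proof. by apply: lb_le_inf (linf_norm_nonempty f) _ => c []. Qed.

Lemma linf_norm_le f c : 0 <= c -> (forall t, `|f t| <= c) -> linf_norm f <= c.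
Proof. by move=> c0 fc; apply: ge_inf => //; exists 0 => x []. Qed.

Lemma linf_normD f g : linf_norm (f + g) <= linf_norm f + linf_norm g.
Proof.
apply: linf_norm_le => [|t]; first by rewrite addr_ge0 ?linf_norm_ge0.
by rewrite (le_trans (ler_normD _ _))// lerD ?linf_norm_ge.
Qed.

Lemma linf_normZ_le (a : R) f : linf_norm (a *: f) <= `|a| * linf_norm f.
Proof.
apply: linf_norm_le => [|t]; first by rewrite mulr_ge0 ?linf_norm_ge0.
by rewrite normrM ler_wpM2l ?linf_norm_ge.
Qed.

Lemma linf_normZ (a : R) f : linf_norm (a *: f) = `|a| * linf_norm f.
Proof.
apply/eqP; rewrite eq_le linf_normZ_le /=.
have [->|a0] := eqVneq a 0; first by rewrite normr0 mul0r linf_norm_ge0.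
(* The converse is the inequality already proved, applied to [a^-1] and [a *: f]. *)
rewrite -ler_pdivlMl ?normr_gt0// -normfV.
by rewrite -{1}[f]scale1r -(mulVf a0) -scalerA linf_normZ_le.
Qed.

Lemma linf_norm0_eq0 f : linf_norm f = 0 -> f = 0.
Proof.
move=> f0; apply/val_inj/funext => t; apply/normr0_eq0/eqP.
by rewrite -normr_le0 normr_id -f0 linf_norm_ge.
Qed.

HB.instance Definition _ :=
  Lmodule_isNormed.Build R linf linf_normD linf_normZ linf_norm0_eq0.

(** Pointwise limits along [F] define [l]. A ball around [f] belonging to [F] bounds [l t - f t]
    uniformly in [t], which yields both boundedness of [l] and convergence in norm. *)
Lemma linf_cauchy_cvg (F : set_system linf) :
  ProperFilter F -> cauchy F -> cvg F.
Proof.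
move=> FF Fc.
have Fball (e : R) : 0 < e -> exists f, F (ball f e).
  by move/cauchyP: Fc => /[apply].
have ev_cvg t : cvg ((fun f => f t : R^o) @ F).
  apply/cauchy_cvgP/cauchyP => e /Fball[f Ff]; exists (f t).
  suff : F [set g | ball (f t : R^o) e (g t)] by [].
  apply: filterS Ff => g; rewrite -!ball_normE /=; apply: le_lt_trans.
  exact: (linf_norm_ge (f - g) t).
pose l t := lim ((fun f => f t : R^o) @ F).
have lP e f : 0 < e -> F (ball f e) -> forall t, `|l t - f t| <= e.
  move=> e0 Ff t; apply/ler_addgt0Pr => d d0.
  have /cvgrPdist_lt/(_ _ d0) Fl := ev_cvg t.
  have [g [/= lg]] := @filter_ex _ F _ _ (@filterI _ F _ _ _ Fl Ff).
  rewrite -ball_normE /= => fg.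
  rewrite [leRHS]addrC (le_trans (ler_distD (g t) _ _))// lerD ?(ltW lg)//.
  rewrite distrC (le_trans _ (ltW fg))//.
  exact: (linf_norm_ge (f - g) t).
have lb : l \in linf_pred.
  have [f Ff] := Fball 1 ltr01; apply/asboolP.
  exists (1 + linf_norm f) => t.
  rewrite -[l t](subrK (f t)) (le_trans (ler_normD _ _))// lerD ?linf_norm_ge//.
  exact: lP.
apply/cvg_ex; exists (Linf lb); apply/cvgrPdist_le => e e0.
have e2 : 0 < e / 2 by rewrite divr_gt0.
have [f Ff] := Fball _ e2.
apply: filterS (Ff) => g; rewrite -ball_normE /= => fg.
rewrite (le_trans (ler_distD f _ _))// [leRHS]splitr lerD ?(ltW fg)//.
apply: linf_norm_le => [|t]; first exact: ltW.
exact: lP.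
Qed.

HB.instance Definition _ := Uniform_isComplete.Build linf linf_cauchy_cvg.

End LInfty.

(** * Evaluation on the real line and its copy of l^1 *)

Section LipschitzEvaluation.
Context {R : realType}.

Definition lip1 := {phi : R -> R |
  phi 0 = 0 /\ forall x y, `|phi x - phi y| <= `|x - y|}.

Fact lip1_eval_bounded (t : R) :
  (fun phi : lip1 => sval phi t) \in @linf_pred R lip1.
Proof.
apply/asboolP; exists `|t| => -[phi [phi0 phiL]] /=.
by have := phiL t 0; rewrite phi0 !subr0.
Qed.

(** The closed span of these evaluations is the Lipschitz-free space of [R]. *)
Definition lip1_eval (t : R) : linf lip1 := Linf (lip1_eval_bounded t).

Lemma lip1_eval0 : lip1_eval 0 = 0.
Proof. by apply/val_inj/funext => -[phi []]. Qed.

Lemma lip1_eval_lip (s t : R) : `|lip1_eval s - lip1_eval t| <= `|s - t|.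
Proof. by apply: linf_norm_le => // -[phi [phi0 phiL]]; apply: phiL. Qed.

Lemma linf_sumE (T : Type) (n : nat) (F : 'I_n -> @linf R T) (t : T) :
  (\sum_i F i : linf T) t = \sum_i F i t.
Proof. exact: (big_morph (fun f : linf T => f t)). Qed.

Let clamp (i : nat) (t : R) : R := Num.min (Num.max t 0) i%:R.

(** The primitive, zero at [0], of the indicator of [[i, i+1]], written as a difference so that sums
    over [i] telescope. *)
Let ramp (i : nat) (t : R) : R := clamp i.+1 t - clamp i t.

Let max_lip (x y : R) : x <= y ->
  [/\ 0 <= Num.max x 0, Num.max x 0 <= Num.max y 0 &
      Num.max y 0 - Num.max x 0 <= y - x].
Proof.
move=> xy; rewrite /Num.max; split;
  do ?[case: ifPn; rewrite -?leNgt => ?]; lra.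
Qed.

Let rampM i x y : x <= y -> ramp i x <= ramp i y.
Proof.
move=> /max_lip[u0 uv _]; rewrite /ramp /clamp -natr1.
by rewrite /Num.min; do ?[case: ifPn; rewrite -?leNgt => ?]; lra.
Qed.

Let clamp_nat (i j : nat) : clamp i j%:R = (minn j i)%:R.
Proof. by rewrite /clamp max_l// natr_min. Qed.

Let ramp_nat (i j : nat) : ramp i j.+1%:R - ramp i j%:R = (i == j)%:R.
Proof.
rewrite /ramp !clamp_nat.
(* Arranged with sums only, since subtraction on [nat] truncates. *)
have : (minn j.+1 i.+1 + minn j i = (i == j) + minn j.+1 i + minn j i.+1)%N.
  by lia.
move/(congr1 (fun n => n%:R : R)); rewrite !natrD; lra.
Qed.

(** The slopes [s i] live on disjoint intervals. For [x <= y], monotone ramps bound the increment by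
    [\sum_i (ramp i y - ramp i x)], which telescopes to an increment of [clamp n], at most
    [y - x]. *)
Lemma ramp_sum_lip (n : nat) (s : 'I_n -> R) (x y : R) :
  (forall i, `|s i| <= 1) ->
  `|\sum_i s i * ramp i x - \sum_i s i * ramp i y| <= `|x - y|.
Proof.
move=> s1; wlog xy : x y / x <= y => [th|].
  by have [/th//|/ltW/th] := leP x y; rewrite distrC (distrC y).
rewrite distrC (distrC x) [leRHS]ger0_norm ?subr_ge0// -sumrB.
have le_ramp : \sum_(i < n) (ramp i y - ramp i x) <= y - x.
  rewrite sumrB /ramp -!(big_mkord xpredT (fun i => clamp i.+1 _ - clamp i _)).
  rewrite !telescope_sumr// /clamp.
  have [u0 uv vuyx] := max_lip xy; have n0 := ler0n R n.
  by rewrite /Num.min; do ?[case: ifPn; rewrite -?leNgt => ?]; lra.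
apply: le_trans le_ramp; rewrite (le_trans (ler_norm_sum _ _ _))// ler_sum//.
move=> i _; rewrite -mulrBr normrM [X in _ * X]ger0_norm ?subr_ge0 ?rampM//.
by rewrite ler_piMl// subr_ge0 rampM.
Qed.

(** Test the combination against the function [phi] in [lip1] whose slope on [[i, i+1]] is the sign
    of [c i]; by [ramp_nat] the value there is exactly the left-hand side. *)
Lemma lip1_eval_l1 (n : nat) (c : 'I_n -> R) :
  \sum_i `|c i| <=
  `|\sum_i c i *: (lip1_eval i.+1%:R - lip1_eval i%:R)|.
Proof.
pose phi t := \sum_i Num.sg (c i) * ramp i t.
have phiP : phi 0 = 0 /\ forall x y, `|phi x - phi y| <= `|x - y|.
  split=> [|x y]; last first.
    by apply: ramp_sum_lip => i; rewrite normr_sg lern1 leq_b1.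
  rewrite /phi big1// => i _.
  by rewrite /ramp /clamp maxxx !min_l// subrr mulr0.
have := linf_norm_ge (\sum_i c i *: (lip1_eval i.+1%:R - lip1_eval i%:R))
  (exist _ phi phiP).
apply: le_trans; rewrite linf_sumE (le_trans _ (ler_norm _))// ler_sum// => i _.
rewrite -[leRHS]/(c i * (phi i.+1%:R - phi i%:R)) /phi -sumrB.
rewrite (bigD1 i)//= big1 ?addr0 => [|j ji]; last first.
  by rewrite -mulrBr ramp_nat val_eqE (negbTE ji) mulr0.
by rewrite -mulrBr ramp_nat eqxx mulr1 mulrC -normrEsg.
Qed.

End LipschitzEvaluation.

(** The left kernel has rank [n.+1 - \rank M], positive because [\rank M] is at most [n]. *)
Lemma linear_dependence (R : realType) (n : nat) (M : 'M[R]_(n.+1, n)) :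
  exists2 c : 'rV[R]_n.+1, c *m M = 0 & c != 0.
Proof.
have : kermx M != 0.
  by rewrite -mxrank_eq0 mxrank_ker subn_eq0 -ltnNge ltnS rank_leq_col.
by case/rowV0Pn => c /sub_kermxP cM c0; exists c.
Qed.

(** * Lipschitz limits of maps with finite-dimensional range *)

Section Approximation.
Context {R : realType}.
Implicit Types (X Y : pointedMetric R) (E F : completeNormedModType R).

Definition finite_dim_range X E (h : X -> E) : Prop :=
  exists (n : nat) (v : 'I_n -> E),
    forall x, exists c : 'I_n -> R, h x = \sum_(i < n) c i *: v i.

(** Phrased with [lip_bound] because [Lip], an infimum, takes the default value 0 on maps that are
    not Lipschitz. *)
Definition lip_approximable X E (f : X -> E) : Prop :=
  forall e : R, 0 < e -> exists2 h : X -> E,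
    finite_dim_range h & @lip_bound R X (banach_pm E) (f - h) e.

Lemma lip_boundP X E (f : X -> E) (c : R) :
  @lip_bound R X (banach_pm E) f c <->
  0 <= c /\ forall x y, `|f x - f y| <= c * mdist x y.
Proof.
by split=> -[c0 fc]; split=> // x y; move: (fc x y); rewrite distrC.
Qed.

(** The strict inequality provides an actual Lipschitz bound below [e]. *)
Lemma lip_bound_Lip X Y (f : X -> Y) (e : R) :
  Lip0 f -> Lip f < e -> lip_bound f e.
Proof.
move=> [_ f0] /(inf_lt f0)[c [c0 fc] /ltW ce].
split=> [|x y]; first exact: le_trans ce.
by rewrite (le_trans (fc x y))// ler_wpM2r// mdist_ge0.
Qed.

Lemma finite_dim_range0 X E : finite_dim_range (0 : X -> E).
Proof.
by exists 0%N, (fun=> 0) => x; exists (fun=> 0); rewrite big_ord0.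
Qed.

Lemma finite_dim_rangeZD X E (a : R) (f g : X -> E) :
  finite_dim_range f -> finite_dim_range g -> finite_dim_range (a *: f + g).
Proof.
move=> [n [v fv]] [m [w gw]].
exists (n + m)%N, (fun i : 'I_(n + m) =>
  match fintype.split i with inl j => v j | inr j => w j end).
move=> x; have [c fx] := fv x; have [d gx] := gw x.
exists (fun i : 'I_(n + m) =>
  match fintype.split i with inl j => a * c j | inr j => d j end).
rewrite big_split_ord /=; congr (_ + _).
  rewrite -[LHS]/(a *: f x) fx scaler_sumr.
  by apply: eq_bigr => i _; rewrite (unsplitK (inl _ i)) scalerA.
by rewrite gx; apply: eq_bigr => i _; rewrite (unsplitK (inr _ i)).
Qed.

Lemma finite_dim_range_comp X Y E F (g : Y -> X) (h : X -> E) (S : E -> F) :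
  linear S -> finite_dim_range h -> finite_dim_range (S \o h \o g).
Proof.
move=> linS [n [v hv]]; exists n, (S \o v) => y /=.
have [c ->] := hv (g y); exists c.
pose L : {linear E -> F} := HB.pack S (GRing.isLinear.Build R E F _ S linS).
rewrite -[S]/(L : E -> F) linear_sum.
by apply: eq_bigr => i _; rewrite linearZ.
Qed.

(** Here [f] approximates itself; hence restricting an ideal to approximable maps changes nothing on
    finite-dimensional targets. *)
Lemma finite_dim_lip_approximable X E (f : X -> E) :
  finite_dim E -> lip_approximable f.
Proof.
move=> [n [v Ev]] e e0; exists f; first by exists n, v => x; apply: Ev.
apply/lip_boundP; split=> [|x y]; first exact: ltW.
by rewrite subrr subrr normr0 mulr_ge0 ?mdist_ge0 ?ltW.
Qed.

Lemma lip_approximable0 X E : lip_approximable (0 : X -> E).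
Proof.
move=> e e0; exists 0; first exact: finite_dim_range0.
apply/lip_boundP; split=> [|x y]; first exact: ltW.
by rewrite !subrr normr0 mulr_ge0 ?mdist_ge0 ?ltW.
Qed.

Lemma lip_approximableZD X E (a : R) (f g : X -> E) :
  lip_approximable f -> lip_approximable g -> lip_approximable (a *: f + g).
Proof.
move=> fP gP e e0.
(* The two errors enter with weights [|a|] and 1, which add up to the denominator. *)
have d0 : 0 < e / (`|a| + 1) by rewrite divr_gt0// ltr_wpDl.
have [h hfin /lip_boundP[_ fh]] := fP _ d0.
have [k kfin /lip_boundP[_ gk]] := gP _ d0.
exists (a *: h + k); first exact: finite_dim_rangeZD.
apply/lip_boundP; split=> [|x y]; first exact: ltW.
have -> : a *: f + g - (a *: h + k) = a *: (f - h) + (g - k).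
  by rewrite scalerBr opprD addrACA.
set d := f - h in fh *; set d' := g - k in gk *.
rewrite -[X in `|X|]/(a *: d x + d' x - (a *: d y + d' y)).
rewrite opprD addrACA -scalerBr.
have a1 : `|a| + 1 != 0 by rewrite gt_eqF// ltr_wpDl.
rewrite (le_trans (ler_normD _ _))// normrZ.
have -> : e = `|a| * (e / (`|a| + 1)) + e / (`|a| + 1) by field.
by rewrite mulrDl lerD// -mulrA ler_wpM2l.
Qed.

Lemma lip_approximable_closed X E (f : X -> E) :
  (forall e : R, 0 < e -> exists2 g : X -> E,
    lip_approximable g & @lip_bound R X (banach_pm E) (f - g) e) ->
  lip_approximable f.
Proof.
move=> fP e e0; have e2 : 0 < e / 2 by rewrite divr_gt0.
have [g gP /lip_boundP[_ fg]] := fP _ e2.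
have [h hfin /lip_boundP[_ gh]] := gP _ e2.
exists h => //; apply/lip_boundP; split=> [|x y]; first exact: ltW.
have -> : f - h = (f - g) + (g - h) by rewrite addrA subrK.
set d := f - g in fg *; set d' := g - h in gh *.
rewrite -[X in `|X|]/(d x + d' x - (d y + d' y)) opprD addrACA.
by rewrite (le_trans (ler_normD _ _))// [e]splitr mulrDl lerD.
Qed.

Lemma lip_approximable_comp X Y E F (g : Y -> X) (f : X -> E) (S : E -> F) :
  Lip0 g -> bounded_op S -> lip_approximable f ->
  lip_approximable (S \o f \o g).
Proof.
move=> [_ [c [c0 gc]]] [linS [b [b0 Sb]]] fP e e0.
(* Composition multiplies the error by at most [b * c]; adding 1 avoids a zero denominator. *)
have bc0 : 0 < b * c + 1 by rewrite ltr_wpDl ?mulr_ge0.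
have d0 : 0 < e / (b * c + 1) by rewrite divr_gt0.
have [h hfin /lip_boundP[_ fh]] := fP _ d0.
exists (S \o h \o g); first exact: finite_dim_range_comp.
apply/lip_boundP; split=> [|x y]; first exact: ltW.
pose L : {linear E -> F} := HB.pack S (GRing.isLinear.Build R E F _ S linS).
have -> : ((S \o f \o g) - (S \o h \o g)) x -
    ((S \o f \o g) - (S \o h \o g)) y =
    L ((f - h) (g x) - (f - h) (g y)).
  by rewrite !linearB.
rewrite (le_trans (Sb _))// (le_trans (ler_wpM2l b0 (fh _ _)))//.
rewrite (le_trans (ler_wpM2l b0 (ler_wpM2l (ltW d0) (gc _ _))))//.
rewrite !mulrA ler_wpM2r ?mdist_ge0//.
rewrite [leLHS](_ : _ = e * (b * c) / (b * c + 1)); last by ring.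
by rewrite ler_pdivrMr// ler_wpM2l ?ltW// ltrDl.
Qed.

(** Keeping the norm of [K] makes the norm axioms immediate; membership and completeness remain. *)
Definition lip_approximable_part (K : lipClass R) : lipClass R :=
  {| lip_in := fun X E => [set f | lip_in K f /\ lip_approximable f];
     lip_norm := @lip_norm R K |}.

Lemma lip_approximable_part_related (K : lipClass R) :
  lip_related (lip_approximable_part K) K.
Proof.
move=> X E _ Efin; split=> //.
apply/seteqP; split=> [f []//|f Kf]; split=> //.
exact: finite_dim_lip_approximable.
Qed.

Lemma finite_dim_regular : @finite_dim R R^o.
Proof.
exists 1%N, (fun=> 1) => x; exists (fun=> x).
by rewrite big_ord1 /GRing.scale /= mulr1.
Qed.

Lemma lip_approximable_part_ideal (K : lipClass R) :
  banach_lip_ideal K -> banach_lip_ideal (lip_approximable_part K).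
Proof.
move=> Kid; split.
- by move=> X E f [Kf _]; apply: bli_sub Kf.
- move=> X E; have Kb := bli_banach Kid X E; split.
  + split; first exact: bs_zero Kb.
    exact: lip_approximable0.
  + move=> a f g [Kf fP] [Kg gP]; split; first exact: bs_lin Kb _ _ _ Kf Kg.
    exact: lip_approximableZD.
  + by move=> f [Kf _]; apply: bs_ge0 Kb _ Kf.
  + by move=> f [Kf _]; apply: bs_definite Kb _ Kf.
  + by move=> a f [Kf _]; apply: bs_scale Kb _ _ Kf.
  + by move=> f g [Kf _] [Kg _]; apply: bs_triangle Kb _ _ Kf Kg.
  + move=> u uP ucauchy.
    have [l Kl ul] := bs_complete Kb (fun n => (uP n).1) ucauchy.
    (* The norm of [K] dominates [Lip], so the limit in [K] is also a Lipschitz limit of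
       approximable maps. *)
    exists l => //; split=> //; apply: lip_approximable_closed => e e0.
    have [n un] := ul _ e0; exists (u n); first exact: (uP n).2.
    have Kd : lip_in K (u n - l).
      by rewrite addrC -scaleN1r; apply: bs_lin Kb _ _ _ Kl (uP n).1.
    have Kd' : lip_in K (l - u n).
      rewrite -opprB -scaleN1r -[_ *: _]addr0.
      exact: bs_lin Kb _ _ _ Kd (bs_zero Kb).
    apply: lip_bound_Lip; first exact: bli_sub Kd'.
    apply: le_lt_trans (bli_Lip Kid Kd') _.
    rewrite -opprB -scaleN1r (bs_scale Kb _ Kd) normrN1 mul1r.
    exact: un.
- by move=> X E f [Kf _]; apply: (bli_Lip Kid Kf).
- split; first exact: (bli_id Kid).
  exact/finite_dim_lip_approximable/finite_dim_regular.
- exact: (bli_id_norm Kid).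
- move=> Y X E F g f S g0 [Kf fP] Sb; split; first exact: (bli_comp Kid).
  exact: lip_approximable_comp.
- by move=> Y X E F g f S g0 [Kf fP] Sb; apply: (bli_comp_norm Kid).
Qed.

End Approximation.

(** * Lipschitz maps on the real line belong to the composition ideal *)

Lemma bounded_op_id (R : realType) (E : completeNormedModType R) :
  bounded_op (id : E -> E).
Proof. by split=> //; exists 1; split=> // x; rewrite mul1r. Qed.

Lemma finite_rank_approximable (R : realType) (E F : completeNormedModType R)
    (T : E -> F) : finite_rank T -> approximable T.
Proof.
move=> Tfin; split=> [|e e0]; first by case: Tfin.
exists T; split=> //; apply: le_lt_trans e0.
apply: ge_inf; first by exists 0 => c [].
by split=> // x; rewrite /= subrr normr0 mul0r.
Qed.

Lemma approximable_id (R : realType) : approximable (id : R^o -> R^o).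
Proof.
apply: finite_rank_approximable; split; first exact: bounded_op_id.
exact: finite_dim_regular.
Qed.

Section LipOpLip.
Context {R : realType} (A : opClass R) (hA : banach_operator_ideal A).

Lemma op_min_id : op_in (op_min A) (id : R^o -> R^o).
Proof.
exists (opnorm (id : R^o -> R^o) * op_norm A (id : R^o -> R^o) *
  opnorm (id : R^o -> R^o)), R^o, R^o, id, id, id.
split=> //; [exact: approximable_id|exact: boi_id hA|exact: approximable_id].
Qed.

Lemma Lip0_id (X : pointedMetric R) : Lip0 (id : X -> X).
Proof. by split=> //; exists 1; split=> // x y; rewrite mul1r. Qed.

(** The nonlinear outer factor absorbs all of [f], leaving the identity of [R] as the operator in
    the minimal kernel. *)
Lemma lip_op_lip_min_real (E : completeNormedModType R) (f : R^o -> E) :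
  @Lip0 R (banach_pm R^o) (banach_pm E) f ->
  @lip_in R (lip_op_lip (op_min A)) (banach_pm R^o) E f.
Proof.
move=> f0; eexists; exists R^o, R^o, id, id, f; split=> //.
- exact: Lip0_id.
- exact: op_min_id.
Qed.

End LipOpLip.

(** * The evaluation map is not approximable; conclusion *)

Lemma lip1_eval_not_approximable (R : realType) :
  ~ @lip_approximable R (banach_pm R^o) (linf (@lip1 R)) (@lip1_eval R).
Proof.
(* Any error below 1, the constant in [lip1_eval_l1], would lead to the contradiction. *)
have half0 : 0 < 2^-1 :> R by rewrite invr_gt0.
move=> /(_ _ half0)[h [n [v hv]] /lip_boundP[_ fh]].
have [c hc] := choice hv.
(* Row [i] holds coordinates, along [v], of the increment of [h] from [i] to [i+1]: one row more
   than there are columns. *)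
pose M := \matrix_(i < n.+1, j < n) (c i.+1%:R j - c i%:R j).
have [d dM d0] := linear_dependence M.
pose f := @lip1_eval R.
have dh : \sum_i d 0 i *: (h i.+1%:R - h i%:R) = 0.
  under eq_bigr do rewrite !hc -sumrB scaler_sumr.
  rewrite exchange_big big1// => j _.
  transitivity ((d *m M) 0 j *: v j); last by rewrite dM mxE scale0r.
  rewrite mxE scaler_suml; apply: eq_bigr => i _.
  by rewrite mxE -scalerBl scalerA.
have le_half : \sum_i `|d 0 i| <= \sum_i `|d 0 i| / 2.
  apply: le_trans (lip1_eval_l1 (d 0)) _.
  (* The relation [dh] lets the increments of [h] be subtracted without changing the sum. *)
  have -> : \sum_i d 0 i *: (f i.+1%:R - f i%:R) =
      \sum_i d 0 i *: ((f - h) i.+1%:R - (f - h) i%:R).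
    rewrite -[LHS]subr0 -[X in _ - X = _]dh -sumrB; apply: eq_bigr => i _.
    by rewrite -scalerBr opprD addrACA -opprD.
  rewrite (le_trans (ler_norm_sum _ _ _))// ler_sum// => i _.
  rewrite normrZ ler_wpM2l// (le_trans (fh _ _))//.
  rewrite -[mdist _ _]/(`|i%:R - i.+1%:R : R|).
  by rewrite distrC -natrB// subSnn normr1 mulr1.
case/negP: d0; apply/eqP/rowP => i; rewrite mxE; apply/normr0_eq0/eqP.
(* A nonnegative sum at most half of itself vanishes, which forces [d = 0]. *)
have sum0 : \sum_i `|d 0 i| == 0.
  rewrite eq_le sumr_ge0// andbT; move: le_half; rewrite -mulr_suml; lra.
move: sum0; rewrite psumr_eq0// => /allP/(_ i).
by rewrite mem_index_enum => /(_ isT).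
Qed.

Theorem corollary2p12 (R : realType) (A : opClass R)
  (hA : banach_operator_ideal A) :
  ~ lip_minimal (lip_op_lip (op_min A)).
Proof.
case=> K [Kid KI Kmin] [IK _].
(* Relatedness passes through [K], so the approximable part of [K] competes in the minimality of
   [K]. *)
have JI : lip_related (lip_approximable_part K) (lip_op_lip (op_min A)).
  move=> X E Xfin Efin.
  have [JK nJK] := lip_approximable_part_related K Xfin Efin.
  have [KIin nKI] := KI X E Xfin Efin.
  by split=> [|f Jf]; rewrite ?JK// nJK// nKI// -JK.
have f0 : @Lip0 R (banach_pm R^o) (banach_pm (linf (@lip1 R))) (@lip1_eval R).
  split; first exact: lip1_eval0.
  exists 1; apply/lip_boundP; split=> // x y.
  by rewrite mul1r (le_trans (lip1_eval_lip _ _))// distrC.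
(* Equality with [K] puts the evaluation map in [K]; minimality then makes it approximable. *)
have [Kf _] := IK _ _ _ (lip_op_lip_min_real hA f0).
have [[_ fP] _] := Kmin _ (lip_approximable_part_ideal Kid) JI _ _ _ Kf.
exact: lip1_eval_not_approximable fP.
Qed.
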